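(* Let $d,k\ge1$ and let $\lambda_1,\dots,\lambda_k>0$. Let $\{N_1(A),\ A\in\mathcal{A}_d\},\dots,\{N_k(A),\ A\in\mathcal{A}_d\}$ be independent Poisson random fields with rates (transition intensities) $\lambda_1,\dots,\lambda_k$, respectively, and let $\{M(A),\ A\in\mathcal{A}_d\}\sim GPRF\{\lambda_j\}_{1\le j\le k}$ be the generalized Poisson random field defined by $M(A)=\sum_{j=1}^{k}jN_j(A)$, $A\in\mathcal{A}_d$. Let $\{Z_r^{(j)}\}_{r\ge1}$, $j=1,\dots,k$, be independent sequences of iid random variables such that $\Pr\{Z_1^{(j)}=j\}=p_j$ and $\Pr\{Z_1^{(j)}=0\}=1-p_j$, where $p_j\in(0,1)$ for each $j=1,\dots,k$. Assume additionally that the sequences $\{Z_r^{(j)}\}_{r\ge1}$ are independent of $\{M(A),\ A\in\mathcal{A}_d\}$. Define the random field $$S_M(A)=\sum_{j=1}^{k}\sum_{r=1}^{N_j(A)}Z_r^{(j)},\quad A\in\mathcal{A}_d.$$ Then $\{S_M(A),\ A\in\mathcal{A}_d\}\sim GPRF\{\lambda_jp_j\}_{1\le j\le k}$ and $\{M(A)-S_M(A),\ A\in\mathcal{A}_d\}\sim GPRF\{\lambda_j(1-p_j)\}_{1\le j\le k}$. Moreover, $S_M(A)$ and $M(A)-S_M(A)$ are independent for each $A\in\mathcal{A}_d$.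
   Context: $\mathbb{R}_+=[0,\infty)$, and $\mathcal{A}_d=\{[\mathbf{0},\mathbf{x}],\ \mathbf{x}\in\mathbb{R}^d_+\}$ is the collection of rectangles in $\mathbb{R}^d_+$, where $[\mathbf{0},\mathbf{x}]=\prod_{j=1}^{d}[0,x_j]$ for $\mathbf{x}=(x_1,\dots,x_d)$; $|A|$ is the Lebesgue measure of $A$. Poisson random field (PRF) with rate $\lambda>0$: a non-negative integer valued random measure $\{N(A),\ A\in\mathcal{A}_d\}$ such that, for any $A\in\mathcal{A}_d$ with $|A|<\infty$, $N(A)$ has Poisson distribution with mean $\lambda|A|$, and for any finite collection $\{A_1,\dots,A_m\}\subset\mathcal{A}_d$ of disjoint sets, $N(A_1),\dots,N(A_m)$ are independent. Generalized Poisson random field $GPRF\{\lambda_j\}_{1\le j\le k}$ (with $\lambda_1,\dots,\lambda_k>0$): a non-negative integer valued random measure $\{M(A),\ A\in\mathcal{A}_d\}$ such that, for any $A\in\mathcal{A}_d$ with $|A|<\infty$, $$\Pr\{M(A)=n\}=\sum_{(n_1,\dots,n_k)\in\Theta(k,n)}\ \prod_{j=1}^{k}\frac{(\lambda_j|A|)^{n_j}}{n_j!}e^{-\lambda_j|A|},\quad n\ge0,$$ where $\Theta(k,n)=\{(n_1,\dots,n_k)\in\mathbb{N}_0^k:\sum_{j=1}^{k}jn_j=n\}$, and for any collection $\{A_1,\dots,A_m\}\subset\mathcal{A}_d$ of disjoint sets, $m\ge2$, $M(A_1),\dots,M(A_m)$ are independent.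
   Formalization: The sequences Z^{(j)} are assumed independent of the fields N_1,…,N_k jointly, not only of {M(A)}: with the definitions as given, independence of M alone does not suffice, since M need not determine the N_j. *)

(* Defs.v *)
From HB Require Import structures.
From mathcomp Require Import all_boot all_order all_algebra.
From mathcomp Require Import all_classical all_reals all_analysis.
Set Implicit Arguments.
Unset Strict Implicit.
Unset Printing Implicit Defensive.
Import Order.TTheory GRing.Theory Num.Theory.
Local Open Scope classical_set_scope.
Local Open Scope ring_scope.

(* R^d is the type d.-tuple R, as in the library's product sigma-algebra.     *)
(* rectangles R d is A_d.                                                     *)
Definition rectangles (R : realType) (d : nat) : set (set (d.-tuple R)) :=
  [set A | exists x : d.-tuple R, (forall i, 0 <= tnth x i) /\
     A = [set y | forall i, 0 <= tnth y i <= tnth x i]].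

(* d-dimensional Lebesgue measure as the iterated product measure: in         *)
(* dimension n.+1 this is the value at A of the product of lebesgue_measure   *)
(* and the n-dimensional measure, i.e. the integral of the measures of the    *)
(* sections of A. In dimension 0 it is the counting measure on a point.       *)
Fixpoint lebesgue_tuple (R : realType) (n : nat) :
    set (n.-tuple R) -> \bar R :=
  match n return set (n.-tuple R) -> \bar R with
  | 0%N => fun A => \d_([tuple] : 0.-tuple R) A
  | m.+1 => fun A => (\int[@lebesgue_measure R]_x
      @lebesgue_tuple R m [set t : m.-tuple R | A [tuple of x :: t]])%E
  end.

Section independence.
Context (dO : measure_display) (Omega : measurableType dO) (R : realType).
Variable P : probability Omega R.

Definition sigma_family (I : Type) (D : set I) (dT : measure_display)
    (T : measurableType dT) (X : I -> Omega -> T) : set (set Omega) :=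
  <<s \bigcup_(i in D) g_sigma_algebra_preimage (X i) >>.

Definition mutually_independent (I : eqType) (G : I -> set (set Omega)) :=
  forall (s : seq I) (E : I -> set Omega),
    uniq s -> (forall i, i \in s -> G i (E i)) ->
    (P (\big[setI/setT]_(i <- s) E i) = \prod_(i <- s) P (E i))%E.

Definition independent (G H : set (set Omega)) :=
  forall E F, G E -> H F -> (P (E `&` F) = P E * P F)%E.

Definition iid (X : nat -> {RV P >-> R}) :=
  mutually_independent (fun r => g_sigma_algebra_preimage (X r)) /\
  forall r B, measurable B -> distribution P (X r) B = distribution P (X 0) B.

End independence.

Section random_fields.
Context (dO : measure_display) (Omega : measurableType dO) (R : realType).
Variable P : probability Omega R.

(* A non-negative integer valued measure on a class C of sets that need not   *)
(* be a semiring: additivity is required of every countable (finite or        *)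
(* infinite, indexed by D) disjoint family in C whose union is again in C.    *)
Definition integer_measure_on (T : Type) (C : set (set T))
    (mu : set T -> R) :=
  (forall A, C A -> exists n : nat, mu A = n%:R) /\
  (forall (D : set nat) (F : nat -> set T),
     (forall i, D i -> C (F i)) -> trivIset D F ->
     C (\bigcup_(i in D) F i) ->
     ((mu (\bigcup_(i in D) F i))%:E = \esum_(i in D) (mu (F i))%:E)%E).

(* The paths are only required to be integer valued measures almost surely,   *)
(* since random sums of variables with Pr{Z = j} + Pr{Z = 0} = 1 are only     *)
(* almost surely non-negative integers.                                       *)
Definition integer_random_measure (T : Type) (C : set (set T))
    (X : set T -> Omega -> R) :=
  (forall A, C A -> measurable_fun setT (X A)) /\
  {ae P, forall w, integer_measure_on C (fun A => X A w)}.

(* The Poisson probabilities are written out because poisson_pmf is not the   *)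
(* Dirac mass at 0 when the mean is 0, which happens for null rectangles.     *)
Definition PRF (d : nat) (lambda : R)
    (N : set (d.-tuple R) -> Omega -> nat) :=
  [/\ integer_random_measure (@rectangles R d) (fun A w => (N A w)%:R),
      forall A, rectangles A -> (lebesgue_tuple A < +oo)%E -> forall n : nat,
        let mean := lambda * fine (lebesgue_tuple A) in
        P [set w | N A w = n] = (mean ^+ n / n`!%:R * expR (- mean))%:E
    & forall (m : nat) (A : 'I_m -> set (d.-tuple R)),
        (forall i, rectangles (A i)) -> trivIset setT A ->
        mutually_independent P (fun i => g_sigma_algebra_preimage (N (A i)))].

(* The index j : 'I_k stands for the index j.+1 of 1, ..., k. The entries of  *)
(* an element of Theta(k, n) are at most n because their weights are >= 1.    *)
Definition Theta (k n : nat) : {set {ffun 'I_k -> 'I_n.+1}} :=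
  [set f : {ffun 'I_k -> 'I_n.+1} | (\sum_(j < k) j.+1 * f j == n)%N].

Definition GPRF (d k : nat) (lambda : 'I_k -> R)
    (M : set (d.-tuple R) -> Omega -> R) :=
  [/\ integer_random_measure (@rectangles R d) M,
      forall A, rectangles A -> (lebesgue_tuple A < +oo)%E -> forall n : nat,
        let mean j := lambda j * fine (lebesgue_tuple A) in
        P [set w | M A w = n%:R] =
          (\sum_(f in Theta k n) \prod_(j < k)
             (mean j ^+ f j / (f j)`!%:R * expR (- mean j)))%:E
    & forall (m : nat) (A : 'I_m -> set (d.-tuple R)), (2 <= m)%N ->
        (forall i, rectangles (A i)) -> trivIset setT A ->
        mutually_independent P (fun i => g_sigma_algebra_preimage (M (A i)))].

End random_fields.

(* Main.v *)
Require Import Defs.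
From HB Require Import structures.
From mathcomp Require Import all_boot all_order all_algebra.
From mathcomp Require Import all_classical all_reals all_analysis.
From mathcomp Require Import ring.
Set Implicit Arguments.
Unset Strict Implicit.
Unset Printing Implicit Defensive.
Import Order.TTheory GRing.Theory Num.Theory.
Local Open Scope classical_set_scope.
Local Open Scope ring_scope.

(* Write B j r for the event Z j r <> 0. Almost surely S A = \sum_j j T_j and
   M A - S A = \sum_j j U_j, where T_j and U_j count the successes and the
   failures among the first N_j A trials. Given N_j A = t + u, the variable T_j
   is binomial, and
     e^-x x^(t+u)/(t+u)! * C(t+u,t) p^t (1-p)^u
   splits as the product of the Poisson weights of means x p and x (1 - p), so
   T_j and U_j are independent Poisson variables; the pairs (T_j, U_j) are
   independent over j. Grouping the values of (T_j)_j and (U_j)_j by their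
   weighted sums gives the two laws and the independence. Any two rectangles
   meet at the origin, so the conditions on disjoint rectangles are void. *)

(** * Independence tested on the cells of natural-valued maps *)

Lemma measurable_preimage_nat (d : measure_display) (T : measurableType d)
    (X : T -> nat) (A : set nat) :
  (forall n, measurable (X @^-1` [set n])) -> measurable (X @^-1` A).
Proof.
move=> mX; rewrite -(image_id A) -bigcup_imset1 preimage_bigcup.
exact: bigcup_measurable.
Qed.

Section independence_lemmas.
Context (dO : measure_display) (Omega : measurableType dO) (R : realType).
Variable P : probability Omega R.

Lemma measure_partition (X : Omega -> nat) (E : set Omega) :
  (forall n, measurable (X @^-1` [set n])) -> measurable E ->
  (P E = \sum_(0 <= n <oo) P (E `&` X @^-1` [set n]))%E.
Proof.
move=> mX mE; rewrite -measure_semi_bigcup.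
- congr (P _); rewrite -setI_bigcupr -preimage_bigcup bigcup_imset1 image_id.
  by rewrite preimage_setT setIT.
- by move=> n; exact: measurableI.
- by move=> i j _ _ [w [[_ /= <-] [_ /= <-]]].
- by rewrite -setI_bigcupr; apply: measurableI => //; exact: bigcup_measurable.
Qed.

(** Both sides are sums over the cells [X = n], so the product formula for [E] and [D] can be
    checked cell by cell. *)
Lemma prob_setI_partition (X : Omega -> nat) (E D : set Omega) :
  (forall n, measurable (X @^-1` [set n])) -> measurable E -> measurable D ->
  (forall n, P ((E `&` X @^-1` [set n]) `&` D) =
             P (E `&` X @^-1` [set n]) * P D)%E ->
  (P (E `&` D) = P E * P D)%E.
Proof.
move=> mX mE mD ED; rewrite (measure_partition mX (measurableI _ _ mE mD)).
rewrite (measure_partition mX mE) muleC -(fineK (fin_num_measure P _ mD)).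
rewrite -nneseriesZl//; apply: eq_eseriesr => n _.
by rewrite setIAC ED fineK ?fin_num_measure// muleC.
Qed.

Lemma mutually_independent_sub (I : eqType) (G H : I -> set (set Omega)) :
  (forall i, H i `<=` G i) -> mutually_independent P G ->
  mutually_independent P H.
Proof. by move=> HG iG s E us HE; apply: iG => // i /HE /HG. Qed.

Lemma bigsetI_measurable_seq (I : eqType) (s : seq I) (E : I -> set Omega) :
  (forall i, i \in s -> measurable (E i)) ->
  measurable (\big[setI/setT]_(i <- s) E i).
Proof.
move=> mE; rewrite big_seq; elim/big_ind: _ => //; exact: measurableI.
Qed.

(* The coordinates are passed from G to H one at a time, summing over the
   cells X i = n. *)
Lemma mutually_independent_refine (I : eqType) (G H : I -> set (set Omega))
    (X : I -> Omega -> nat) :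
  (forall i n, measurable (X i @^-1` [set n])) ->
  (forall i E, G i E -> measurable E) -> (forall i E, H i E -> measurable E) ->
  (forall i E n, H i E -> G i (E `&` X i @^-1` [set n])) ->
  mutually_independent P G -> mutually_independent P H.
Proof.
move=> mX mG mH HG iG s E us HE.
have mixed (t : seq I) : uniq t -> forall s' E', uniq (t ++ s') ->
    (forall i, i \in t -> H i (E' i)) -> (forall i, i \in s' -> G i (E' i)) ->
    (P (\big[setI/setT]_(i <- t ++ s') E' i) =
     \prod_(i <- t ++ s') P (E' i))%E.
  elim: t {s E us HE} => [_ s E us _ GE|x t IH /= /andP[xt ut] s E].
    exact: iG.
  move=> /andP[xts uts] HE GE; rewrite !big_cons.
  have HEt i : i \in t -> H i (E i) by move=> it; apply: HE; rewrite inE it orbT.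
  rewrite -IH//; apply: (prob_setI_partition (mX x)).
  - by apply: (mH x); apply: HE; rewrite mem_head.
  - by apply: bigsetI_measurable_seq => i; rewrite mem_cat => /orP[/HEt/mH|/GE/mG].
  (* Cut down to the cell, the event at [x] belongs to [G x], so [x] can leave the head of the [H]
     list and join the [G] list, where the induction hypothesis applies. *)
  move=> n; pose E' i := if i == x then E x `&` X x @^-1` [set n] else E i.
  have E'E i : i \in t ++ s -> E' i = E i.
    by rewrite /E'; case: eqP => // -> /(negP xts).
  have perm_xts : perm_eq (t ++ x :: s) (x :: t ++ s) by rewrite -cat1s perm_catCA.
  have E'x : E' x = E x `&` X x @^-1` [set n] by rewrite /E' eqxx.
  have -> : \big[setI/setT]_(i <- t ++ s) E i = \big[setI/setT]_(i <- t ++ s) E' i.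
    by apply: eq_big_seq => i /E'E ->.
  have -> : (P (\big[setI/setT]_(i <- t ++ s) E' i) = \prod_(i <- t ++ s) P (E' i))%E.
    apply: IH => // i it; first by rewrite E'E ?mem_cat ?it//; exact: HEt.
    by rewrite E'E ?mem_cat ?it ?orbT//; exact: GE.
  rewrite -E'x -(big_cons _ _ _ _ xpredT E') -(big_cons _ _ _ _ xpredT (P \o E')).
  rewrite -!(perm_big _ perm_xts); apply: IH => //.
  - by rewrite (perm_uniq perm_xts) /= xts.
  - by move=> i it; rewrite E'E ?mem_cat ?it//; exact: HEt.
  - move=> i; rewrite inE => /orP[/eqP ->|is_].
      by rewrite E'x; apply: HG; apply: HE; rewrite mem_head.
    by rewrite E'E ?mem_cat ?is_ ?orbT//; exact: GE.
by have := mixed s us [::] E; rewrite cats0; apply.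
Qed.

(** The preimage of a set of naturals meets the cell of value [n] in the whole cell or in nothing,
    so the product formula for single values extends along the cells of [X], then along those of
    [Y]. *)
Lemma independent_nat_valued (X Y : Omega -> nat) (B C : set nat) :
  (forall n, measurable (X @^-1` [set n])) ->
  (forall n, measurable (Y @^-1` [set n])) ->
  (forall m n, P (X @^-1` [set m] `&` Y @^-1` [set n]) =
               P (X @^-1` [set m]) * P (Y @^-1` [set n]))%E ->
  (P (X @^-1` B `&` Y @^-1` C) = P (X @^-1` B) * P (Y @^-1` C))%E.
Proof.
have preI (Z : Omega -> nat) D n :
    Z @^-1` D `&` Z @^-1` [set n] = if n \in D then Z @^-1` [set n] else set0.
  rewrite -preimage_setI setI1; case: ifP => // _; exact: preimage_set0.
move=> mX mY XY; apply: (prob_setI_partition mX) => [||m]; try exact: measurable_preimage_nat.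
rewrite preI; case: ifP => _; last by rewrite set0I measure0 mul0e.
rewrite setIC muleC; apply: (prob_setI_partition mY) => // [|n]; first exact: measurable_preimage_nat.
rewrite preI; case: ifP => _; last by rewrite set0I measure0 mul0e.
by rewrite setIC XY muleC.
Qed.

(** Lets real-valued variables be exchanged for natural-valued ones that agree with them only on the
    almost sure event [O]. *)
Lemma prob_eq_ae (O E F : set Omega) : measurable O -> P (~` O) = 0%E ->
  measurable E -> measurable F -> E `&` O = F `&` O -> P E = P F.
Proof.
move=> mO O0 mE mF EF.
have key D : measurable D -> P D = P (D `&` O).
  move=> mD; rewrite (measureDI P mD mO) [X in (X + _)%E](_ : _ = 0%E) ?add0e//.
  apply: (subset_measure0 _ _ _ O0) => //; first exact: measurableD.
  exact: measurableC.
by rewrite (key E)// (key F)// EF.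
Qed.

End independence_lemmas.

(** * Successes among a fixed number of trials *)

Section thinning.

(** Trials are events rather than 0-1 variables, so the failures are counted by the same function
    applied to the complements. *)
Definition success_count (T : Type) (B : nat -> set T) (n : nat) (w : T) : nat :=
  (\sum_(r < n) (w \in B r))%N.

Lemma success_countS (T : Type) (B : nat -> set T) n w :
  success_count B n.+1 w = (success_count B n w + (w \in B n))%N.
Proof. by rewrite /success_count big_ord_recr. Qed.

Lemma success_countC (T : Type) (B : nat -> set T) n w :
  (success_count B n w + success_count (fun r => ~` B r) n w)%N = n.
Proof.
rewrite /success_count -big_split/= (eq_bigr (fun=> 1%N)) ?sum1_card ?card_ord//.
by move=> r _; rewrite in_setC; case: (_ \in _).
Qed.

(** The split on the outcome of trial [n], which underlies Pascal's rule; for [t = 0] only a failure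
    is possible. *)
Lemma success_countS_preimage (T : Type) (B : nat -> set T) n t :
  success_count B n.+1 @^-1` [set t] =
  (success_count B n @^-1` [set t] `&` ~` B n) `|`
  (if t is t'.+1 then success_count B n @^-1` [set t'] `&` B n else set0).
Proof.
apply/seteqP; split => w /=; rewrite success_countS.
  have [/set_mem Bw|/negP] := boolP (w \in B n).
    by rewrite addn1 => <-; right.
  by rewrite inE addn0 => Bw <-; left.
move=> [[<- Bw]|]; first by rewrite memNset// addn0.
by case: t => // t [<- Bw]; rewrite mem_set// addn1.
Qed.

Lemma measurable_success_count (d : measure_display) (T : measurableType d)
    (B : nat -> set T) n t : (forall r, measurable (B r)) ->
  measurable (success_count B n @^-1` [set t]).
Proof.
move=> mB; elim: n t => [|n IH] t.
  have -> : success_count B 0 = cst 0%N by apply/funext => w; rewrite /success_count big_ord0.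
  by rewrite preimage_cst; case: ifP.
rewrite success_countS_preimage; apply: measurableU.
  by apply: measurableI => //; exact: measurableC.
by case: t => // t; exact: measurableI.
Qed.

Context (dO : measure_display) (Omega : measurableType dO) (R : realType).
Variable P : probability Omega R.

Lemma binomial_success_count (B : nat -> set Omega) (p : R) n t :
  (forall r, measurable (B r)) ->
  mutually_independent P (fun r => [set B r; ~` B r]) ->
  (forall r, P (B r) = p%:E) ->
  P (success_count B n @^-1` [set t]) =
    ('C(n, t)%:R * p ^+ t * (1 - p) ^+ (n - t))%:E.
Proof.
move=> mB iB PB; have PCB r : P (~` B r) = (1 - p)%:E.
  by rewrite probability_setC// PB.
have mE r E : [set B r; ~` B r] E -> measurable E.
  by move=> [->|->] //; exact: measurableC.
(* The induction on n needs the trial n to be independent of the first n ones,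
   hence the extra factor of later trials. *)
suff key (s : seq nat) (E : nat -> set Omega) : uniq s ->
    (forall r, r \in s -> (n <= r)%N /\ [set B r; ~` B r] (E r)) ->
    (P (success_count B n @^-1` [set t] `&` \big[setI/setT]_(r <- s) E r) =
     ('C(n, t)%:R * p ^+ t * (1 - p) ^+ (n - t))%:E *
     P (\big[setI/setT]_(r <- s) E r))%E.
  have := key [::] (fun=> setT) isT.
  by rewrite big_nil setIT probability_setT mule1; apply.
elim: n t s E => [|n IH] t s E us sE.
  have -> : success_count B 0 = cst 0%N by apply/funext => w; rewrite /success_count big_ord0.
  rewrite preimage_cst; case: t => [|t].
    by rewrite mem_set// setTI bin0 !mul1r mul1e.
  by rewrite memNset// set0I measure0 bin0n !mul0r mul0e.
have mEs : measurable (\big[setI/setT]_(r <- s) E r).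
  by apply: bigsetI_measurable_seq => r /sE[_ /mE].
have ns : n \notin s by apply/negP => /sE[]; rewrite ltnn.
have step u D : [set B n; ~` B n] D ->
    (P (success_count B n @^-1` [set u] `&` D `&` \big[setI/setT]_(r <- s) E r) =
     ('C(n, u)%:R * p ^+ u * (1 - p) ^+ (n - u))%:E *
     (P D * P (\big[setI/setT]_(r <- s) E r)))%E.
  (* The event [D] of trial [n] is counted among the later trials, so that the induction hypothesis
     applies to the list [n :: s]. *)
  move=> BD; pose E' r := if r == n then D else E r.
  have E'E r : r \in s -> E' r = E r.
    by rewrite /E'; case: eqP => // -> /(negP ns).
  have E'n : E' n = D by rewrite /E' eqxx.
  have Es : \big[setI/setT]_(r <- s) E r = \big[setI/setT]_(r <- s) E' r.
    by apply: eq_big_seq => r /E'E ->.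
  have BE' r : r \in n :: s -> [set B r; ~` B r] (E' r).
    rewrite inE => /orP[/eqP ->|rs]; first by rewrite E'n.
    by rewrite E'E//; have [] := sE _ rs.
  have uns : uniq (n :: s) by rewrite /= ns.
  have := IH u (n :: s) E' uns.
  rewrite big_cons setIA E'n -Es => ->; last first.
    move=> r rs; split; last exact: BE'.
    by move: rs; rewrite inE => /orP[/eqP ->//|/sE[/ltnW]].
  congr (_ * _)%E.
  have := iB (n :: s) E' uns BE'.
  rewrite !big_cons E'n -Es => ->.
  by rewrite Es iB// => r rs; apply: BE'; rewrite inE rs orbT.
pose F t := if t is t'.+1 then success_count B n @^-1` [set t'] `&` B n else set0.
rewrite success_countS_preimage setIUl.
transitivity (P (success_count B n @^-1` [set t] `&` ~` B n
                 `&` \big[setI/setT]_(r <- s) E r) +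
              P (F t `&` \big[setI/setT]_(r <- s) E r))%E.
  apply: measureU; rewrite /F.
  - apply: measurableI => //; apply: measurableI; last exact: measurableC.
    exact: measurable_success_count.
  - apply: measurableI => //; case: t => // t; apply: measurableI => //.
    exact: measurable_success_count.
  - case: t => [|t]; first by rewrite set0I setI0.
    by apply/seteqP; split => // w [[[_ nB] _] [[_ /nB]]].
rewrite {}/F step; last by right.
have -> : P (~` B n) = (1 - p)%:E by exact: PCB.
have [c Pc] : exists c, P (\big[setI/setT]_(r <- s) E r) = c%:E.
  by exists (fine (P (\big[setI/setT]_(r <- s) E r))); rewrite fineK// fin_num_measure.
rewrite Pc; case: t => [|t].
  rewrite set0I measure0 adde0 -!EFinM !bin0 !subn0 exprSr.
  by congr EFin; ring.
rewrite step; last by left.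
rewrite PB Pc -!EFinM -EFinD; congr EFin.
(* Pascal's rule. If [n <= t], the truncated exponent [n - t.+1] no longer drops by one, but its
   coefficient ['C(n, t.+1)] vanishes. *)
rewrite binS natrD subSS exprSr; have [tn|nt] := ltnP t n.
  by rewrite -(subnSK tn) exprSr; ring.
by rewrite bin_small ?ltnS//; ring.
Qed.

End thinning.

(** * Thinning of a single Poisson variable *)

Section poisson_thinning.

(** At [x = 0] this is the point mass at 0, because [0 ^+ 0 = 1]; null rectangles are thus
    covered. *)
Definition poisson_weight (R : realType) (x : R) (n : nat) : R :=
  x ^+ n / n`!%:R * expR (- x).

(** The exponential series times [expR (- x)]. The factor [a] is kept so that summing one coordinate
    out of a product of two weights leaves the other. *)
Lemma poisson_weight_series (R : realType) (a x : R) :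
  (\sum_(0 <= n <oo) (a * poisson_weight x n)%:E = a%:E)%E.
Proof.
rewrite -[in RHS](mulr1 a) -(expRxMexpNx_1 x) mulrCA mulrC.
have cvge : (fun n => \sum_(0 <= i < n) (a * poisson_weight x i)%:E)%E =
    EFin \o (fun n => a * expR (- x) * series (exp_coeff x) n).
  apply/funext => n /=; rewrite sumEFin mulr_sumr; congr EFin.
  by apply: eq_bigr => i _; rewrite /poisson_weight /exp_coeff/=; ring.
rewrite cvge; apply/cvg_lim => //; apply: cvg_EFin; first exact: nearW.
by apply: cvgMr; exact: is_cvg_series_exp_coeff.
Qed.

Lemma poisson_weight_thinning (R : realType) (x p : R) t u :
  poisson_weight x (t + u) * ('C(t + u, t)%:R * p ^+ t * (1 - p) ^+ u) =
  poisson_weight (x * p) t * poisson_weight (x * (1 - p)) u.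
Proof.
have /(congr1 (fun n => n%:R : R)) := bin_fact (leq_addr u t).
(* The factorial of [t + u] is expanded so that the binomial coefficient cancels. *)
rewrite addKn !natrM /poisson_weight => <-.
have -> : - x = - (x * p) + - (x * (1 - p)) by ring.
rewrite expRD !exprMn exprD; field.
by rewrite !pnatr_eq0 -!lt0n !fact_gt0 bin_gt0 leq_addr.
Qed.

Definition thinned (T : Type) (N : T -> nat) (B : nat -> set T) (w : T) : nat :=
  success_count B (N w) w.

Lemma thinnedC (T : Type) (N : T -> nat) (B : nat -> set T) w :
  (thinned N B w + thinned N (fun r => ~` B r) w)%N = N w.
Proof. exact: success_countC. Qed.

(** On the cell [N = n] the random number of trials is the constant [n], which brings the count back
    to the binomial case. *)
Lemma thinned_preimageI (T : Type) (N : T -> nat) (B : nat -> set T) n t :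
  thinned N B @^-1` [set t] `&` N @^-1` [set n] =
  N @^-1` [set n] `&` success_count B n @^-1` [set t].
Proof.
by apply/seteqP; rewrite /thinned; split => w /= [] => [<- <-|<- <-].
Qed.

Lemma measurable_thinned (d : measure_display) (T : measurableType d)
    (N : T -> nat) (B : nat -> set T) t :
  (forall n, measurable (N @^-1` [set n])) -> (forall r, measurable (B r)) ->
  measurable (thinned N B @^-1` [set t]).
Proof.
move=> mN mB; have -> : thinned N B @^-1` [set t] =
    \bigcup_n (thinned N B @^-1` [set t] `&` N @^-1` [set n]).
  rewrite -setI_bigcupr -preimage_bigcup bigcup_imset1 image_id.
  by rewrite preimage_setT setIT.
apply: bigcup_measurable => n _; rewrite thinned_preimageI.
by apply: measurableI => //; exact: measurable_success_count.
Qed.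

Context (dO : measure_display) (Omega : measurableType dO) (R : realType).
Variable P : probability Omega R.
Variables (N : Omega -> nat) (B : nat -> set Omega) (x p : R).
Hypothesis mN : forall n, measurable (N @^-1` [set n]).
Hypothesis mB : forall r, measurable (B r).
Hypothesis iB : mutually_independent P (fun r => [set B r; ~` B r]).
Hypothesis PB : forall r, P (B r) = p%:E.
Hypothesis PN : forall n, P (N @^-1` [set n]) = (poisson_weight x n)%:E.
Hypothesis NB : forall n t,
  (P (N @^-1` [set n] `&` success_count B n @^-1` [set t]) =
   P (N @^-1` [set n]) * P (success_count B n @^-1` [set t]))%E.

(** Having [t] successes and [u] failures means that [N = t + u] and that [t] of the first [t + u]
    trials succeed; these two events are independent by [NB]. *)
Lemma prob_thinned_joint t u :
  P (thinned N B @^-1` [set t] `&` thinned N (fun r => ~` B r) @^-1` [set u]) =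
  (poisson_weight (x * p) t * poisson_weight (x * (1 - p)) u)%:E.
Proof.
(* The exponent [u] is written [t + u - t] to match the binomial law for [t + u] trials. *)
rewrite -poisson_weight_thinning EFinM -PN -[u in (1 - p) ^+ u](addKn t).
rewrite -(binomial_success_count (t + u) t mB iB PB) -NB -thinned_preimageI; congr (P _).
apply/seteqP; split => w [/= Tt Uu]; split => //=.
  by rewrite -Tt -Uu thinnedC.
by apply/eqP; rewrite -(eqn_add2l t) -Uu -{1}Tt thinnedC.
Qed.

(** A marginal of the joint law: the failure count is summed out. *)
Lemma prob_thinned t :
  P (thinned N B @^-1` [set t]) = (poisson_weight (x * p) t)%:E.
Proof.
rewrite (@measure_partition _ _ _ P (thinned N (fun r => ~` B r))) => [|u|].
- under eq_eseriesr do rewrite prob_thinned_joint.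
  exact: poisson_weight_series.
- by apply: measurable_thinned => // r; exact: measurableC.
- exact: measurable_thinned.
Qed.

Lemma prob_thinned_failures u :
  P (thinned N (fun r => ~` B r) @^-1` [set u]) =
  (poisson_weight (x * (1 - p)) u)%:E.
Proof.
rewrite (@measure_partition _ _ _ P (thinned N B)) => [|t|].
- under eq_eseriesr do rewrite setIC prob_thinned_joint mulrC.
  exact: poisson_weight_series.
- exact: measurable_thinned.
- by apply: measurable_thinned => // r; exact: measurableC.
Qed.

End poisson_thinning.

(** * Laws of weighted sums, and independence of intersections *)

Section weighted_sums.

Definition weighted_sum (T : Type) (k : nat) (X : 'I_k -> T -> nat) (w : T) : nat :=
  (\sum_(j < k) j.+1 * X j w)%N.

Lemma bigsetI_ordP (T : Type) (k : nat) (F : 'I_k -> set T) w :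
  (\big[setI/setT]_(j < k) F j) w <-> forall j, F j w.
Proof.
rewrite -bigcap_seq; split=> [Fw j|Fw j _]; last exact: Fw.
by apply: Fw; rewrite /= mem_index_enum.
Qed.

Lemma weighted_sum_preimage (T : Type) (k : nat) (X : 'I_k -> T -> nat) n :
  weighted_sum X @^-1` [set n] = \bigcup_(f in [set` Theta k n])
    \big[setI/setT]_(j < k) (X j @^-1` [set val (f j)]).
Proof.
apply/seteqP; split => w.
(* Here [inord] loses nothing: the weight of [X j w] is at least 1, so [X j w] is at most the total
   [n]. *)
- move=> /= wn; exists [ffun j => inord (X j w)].
    rewrite /= inE -[X in _ == X]wn; apply/eqP/eq_bigr => j _.
    by rewrite ffunE inordK// ltnS -wn /weighted_sum (bigD1 j)//= mulSn -addnA leq_addr.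
  apply/bigsetI_ordP => j /=; rewrite ffunE inordK// ltnS -wn.
  by rewrite /weighted_sum (bigD1 j)//= mulSn -addnA leq_addr.
- move=> [f /=]; rewrite inE => /eqP fn /bigsetI_ordP Xf; rewrite -fn.
  by apply: eq_bigr => j _; rewrite (Xf j).
Qed.

Context (dO : measure_display) (Omega : measurableType dO) (R : realType).
Variable P : probability Omega R.
Variables (k : nat) (X : 'I_k -> Omega -> nat) (a : 'I_k -> nat -> R).
Hypothesis mX : forall j t, measurable (X j @^-1` [set t]).

(** The spare event [D] allows a second weighted sum to be expanded in turn, as the joint law
    requires. *)
Lemma prob_weighted_sumI n D : measurable D ->
  (P (weighted_sum X @^-1` [set n] `&` D) =
   \sum_(f in Theta k n)
     P (\big[setI/setT]_(j < k) (X j @^-1` [set val (f j)]) `&` D))%E.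
Proof.
move=> mD; rewrite bigfs ?index_enum_uniq//; last by move=> i _; rewrite mem_index_enum.
rewrite weighted_sum_preimage setI_bigcupl; apply: measure_fin_bigcup => //.
- move=> f g _ _ [w [[/bigsetI_ordP fw _] [/bigsetI_ordP gw _]]].
  by apply/ffunP => j; apply/val_inj; rewrite -(fw j) -(gw j).
- move=> f _; apply: measurableI => //.
  by apply: bigsetI_measurable_seq => j _; exact: mX.
Qed.

Lemma measurable_weighted_sum n : measurable (weighted_sum X @^-1` [set n]).
Proof.
rewrite weighted_sum_preimage; apply: fin_bigcup_measurable => // f _.
by apply: bigsetI_measurable_seq => j _; exact: mX.
Qed.

Lemma prob_weighted_sum n :
  (forall t : 'I_k -> nat,
    (P (\big[setI/setT]_(j < k) (X j @^-1` [set t j])) =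
     \prod_(j < k) P (X j @^-1` [set t j]))%E) ->
  (forall j t, P (X j @^-1` [set t]) = (a j t)%:E) ->
  P (weighted_sum X @^-1` [set n]) =
    (\sum_(f in Theta k n) \prod_(j < k) a j (f j))%:E.
Proof.
move=> iX PX; rewrite -[X in P X]setIT prob_weighted_sumI// -sumEFin.
apply: eq_bigr => f _; rewrite setIT (iX (fun j => val (f j))) -prodEFin.
by apply: eq_bigr => j _; rewrite PX.
Qed.

End weighted_sums.

(** Expanding both sums leaves cells of the pairs [(X j, Y j)]. Independence over [j] gives a
    product of the [a j * b j], and the double sum factors. *)
Lemma prob_weighted_sum_joint (dO : measure_display) (Omega : measurableType dO)
    (R : realType) (P : probability Omega R) (k : nat)
    (X Y : 'I_k -> Omega -> nat) (a b : 'I_k -> nat -> R) m n :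
  (forall j t, measurable (X j @^-1` [set t])) ->
  (forall j t, measurable (Y j @^-1` [set t])) ->
  (forall t u : 'I_k -> nat,
    (P (\big[setI/setT]_(j < k) (X j @^-1` [set t j] `&` Y j @^-1` [set u j])) =
     \prod_(j < k) P (X j @^-1` [set t j] `&` Y j @^-1` [set u j]))%E) ->
  (forall j t u, P (X j @^-1` [set t] `&` Y j @^-1` [set u]) = (a j t * b j u)%:E) ->
  P (weighted_sum X @^-1` [set m] `&` weighted_sum Y @^-1` [set n]) =
    ((\sum_(f in Theta k m) \prod_(j < k) a j (f j)) *
     (\sum_(g in Theta k n) \prod_(j < k) b j (g j)))%:E.
Proof.
move=> mX mY iXY PXY; rewrite prob_weighted_sumI//; last exact: measurable_weighted_sum.
rewrite mulr_suml -sumEFin; apply: eq_bigr => f _.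
rewrite setIC prob_weighted_sumI//; last first.
  by apply: bigsetI_measurable_seq => j _; exact: mX.
rewrite mulr_sumr -sumEFin; apply: eq_bigr => g _.
rewrite setIC -big_split/= (iXY (fun j => val (f j)) (fun j => val (g j))).
rewrite -big_split/= -prodEFin.
by apply: eq_bigr => j _; rewrite PXY.
Qed.

(** All the [E i] separate from all the [F i], each family factors, and the factors are paired again
    index by index. Used with counts for [G] and trials for [H]. *)
Lemma mutually_independent_setI (dO : measure_display)
    (Omega : measurableType dO) (R : realType) (P : probability Omega R)
    (I : eqType) (G H : I -> set (set Omega)) :
  mutually_independent P G -> mutually_independent P H ->
  (forall (s : seq I) (E F : I -> set Omega), uniq s ->
    (forall i, i \in s -> G i (E i)) -> (forall i, i \in s -> H i (F i)) ->
    (P (\big[setI/setT]_(i <- s) E i `&` \big[setI/setT]_(i <- s) F i) =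
     P (\big[setI/setT]_(i <- s) E i) * P (\big[setI/setT]_(i <- s) F i))%E) ->
  mutually_independent P
    (fun i => [set D | exists E F, [/\ G i E, H i F & D = E `&` F]]).
Proof.
move=> iG iH GH s D us sD.
(* Outside [s] nothing is known of [D i]; the default [setT] only makes the choice total. *)
have /choice[E EP] : forall i, exists E, i \in s ->
    exists F, [/\ G i E, H i F & D i = E `&` F].
  by move=> i; have [/sD[E EF]|_] := boolP (i \in s); [exists E|exists setT].
have /choice[F FP] : forall i, exists F, i \in s ->
    [/\ G i (E i), H i F & D i = E i `&` F].
  by move=> i; have [/EP[F EF]|_] := boolP (i \in s); [exists F|exists setT].
have GE i : i \in s -> G i (E i) by move=> /FP[].
have HF i : i \in s -> H i (F i) by move=> /FP[].
rewrite (eq_big_seq (fun i => E i `&` F i)); last by move=> i /FP[].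
rewrite big_split/= GH// iG// iH// -big_split/= big_seq [RHS]big_seq.
apply: eq_bigr => i si; have [_ _ ->] := FP _ si.
(* The joint hypothesis on a one-element list recombines [E i] and [F i]. *)
have := GH [:: i] E F isT; rewrite !big_seq1 => -> //.
- by move=> j; rewrite inE => /eqP ->; exact: GE.
- by move=> j; rewrite inE => /eqP ->; exact: HF.
Qed.

(** * Simultaneous thinning of independent Poisson variables *)

Section thinned_families.
Context (dO : measure_display) (Omega : measurableType dO) (R : realType).
Variable P : probability Omega R.
Variables (k : nat) (N : 'I_k -> Omega -> nat) (B : 'I_k -> nat -> set Omega).
Variables (x p : 'I_k -> R).
Hypothesis mN : forall j n, measurable (N j @^-1` [set n]).
Hypothesis mB : forall j r, measurable (B j r).
Hypothesis iB : forall j, mutually_independent P (fun r => [set B j r; ~` B j r]).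
Hypothesis PB : forall j r, P (B j r) = (p j)%:E.
Hypothesis PN : forall j n, P (N j @^-1` [set n]) = (poisson_weight (x j) n)%:E.
Hypothesis iN :
  mutually_independent P (fun j => range (fun n => N j @^-1` [set n])).
Hypothesis iBs : mutually_independent P (fun j => <<s range (B j)>>).
Hypothesis iBN : independent P
  <<s range (fun jr : 'I_k * nat => B jr.1 jr.2)>>
  <<s range (fun jn : 'I_k * nat => N jn.1 @^-1` [set jn.2])>>.

Let T j := thinned (N j) (B j).
Let U j := thinned (N j) (fun r => ~` B j r).

Let mT j t : measurable (T j @^-1` [set t]).
Proof. exact: measurable_thinned. Qed.

Let mU j u : measurable (U j @^-1` [set u]).
Proof. by apply: measurable_thinned => // r; exact: measurableC. Qed.

Let success_event_measurable j E : <<s range (B j)>> E -> measurable E.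
Proof.
apply: smallest_sub; first exact: sigma_algebra_measurable.
by move=> _ [r _ <-].
Qed.

(** A finite intersection over [j] stays in the sigma-algebra of all trials, or of all counts, so
    [iBN] applies. Through [g_sigma_algebraType] the general measurability lemmas speak of these
    generated sigma-algebras. *)
Let bigsetI_indep (s : seq 'I_k) (E F : 'I_k -> set Omega) :
  (forall j, j \in s -> range (fun n => N j @^-1` [set n]) (E j)) ->
  (forall j, j \in s -> <<s range (B j)>> (F j)) ->
  (P (\big[setI/setT]_(j <- s) E j `&` \big[setI/setT]_(j <- s) F j) =
   P (\big[setI/setT]_(j <- s) E j) * P (\big[setI/setT]_(j <- s) F j))%E.
Proof.
move=> NE BF; rewrite setIC muleC; apply: iBN.
  apply: (@bigsetI_measurable_seq _ (g_sigma_algebraType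
    (range (fun jr : 'I_k * nat => B jr.1 jr.2)))) => j /BF.
  apply: sub_sigma_algebra2 => _ [r _ <-]; by exists (j, r).
apply: (@bigsetI_measurable_seq _ (g_sigma_algebraType
  (range (fun jn : 'I_k * nat => N jn.1 @^-1` [set jn.2])))) => j /NE[n _ <-].
by apply: sub_sigma_algebra; exists (j, n).
Qed.

(* On [N j = n] the counts of successes and of failures are functions of the
   first n trials only, so the events below refine to products of an event of
   N j and an event of the trials. *)
Lemma mutually_independent_thinned : mutually_independent P
  (fun j => [set E | exists A C, E = T j @^-1` A `&` U j @^-1` C]).
Proof.
apply: (@mutually_independent_refine _ _ _ P _
  (fun j => [set D | exists E F, [/\ range (fun n => N j @^-1` [set n]) E,
     <<s range (B j)>> F & D = E `&` F]]) _ N mN).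
- move=> j _ [E [F [[n _ <-] BF ->]]]; apply: measurableI => //.
  exact: success_event_measurable BF.
- move=> j _ [A [C ->]]; apply: measurableI; exact: measurable_preimage_nat.
- move=> j _ n [A [C ->]]; exists (N j @^-1` [set n]).
  exists (success_count (B j) n @^-1` A `&`
          success_count (fun r => ~` B j r) n @^-1` C); split.
  + by exists n.
  + have mBj r : @measurable _ (g_sigma_algebraType (range (B j))) (B j r).
      by apply: sub_sigma_algebra; exists r.
    apply: (@measurableI _ (g_sigma_algebraType (range (B j))));
      apply: (@measurable_preimage_nat _ (g_sigma_algebraType (range (B j)))) => t;
      apply: (@measurable_success_count _ (g_sigma_algebraType (range (B j)))) => // r.
    exact: (@measurableC _ (g_sigma_algebraType (range (B j)))).
  + by apply/seteqP; rewrite /T /U /thinned; split => w /= [] => [[+ +] Nn|Nn [+ +]];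
      rewrite Nn.
- by apply: mutually_independent_setI => // s E F _; exact: bigsetI_indep.
Qed.

Let NB j n t :
  (P (N j @^-1` [set n] `&` success_count (B j) n @^-1` [set t]) =
   P (N j @^-1` [set n]) * P (success_count (B j) n @^-1` [set t]))%E.
Proof.
have := @bigsetI_indep [:: j] (fun j => N j @^-1` [set n])
  (fun j => success_count (B j) n @^-1` [set t]).
rewrite !big_seq1; apply=> i _; first by exists n.
apply: (@measurable_success_count _ (g_sigma_algebraType (range (B i)))) => r.
by apply: sub_sigma_algebra; exists r.
Qed.

Lemma prob_weighted_successes n :
  P (weighted_sum T @^-1` [set n]) = (\sum_(f in Theta k n)
    \prod_(j < k) poisson_weight (x j * p j) (f j))%:E.
Proof.
apply: (@prob_weighted_sum _ _ _ P k T (fun j => poisson_weight (x j * p j))) => //.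
- move=> t; apply: (mutually_independent_thinned (index_enum_uniq _)) => j _.
  (* The failures are left free. *)
  by exists [set t j], setT; rewrite preimage_setT setIT.
- by move=> j t; exact: prob_thinned.
Qed.

Lemma prob_weighted_joint m n :
  P (weighted_sum T @^-1` [set m] `&` weighted_sum U @^-1` [set n]) =
  ((\sum_(f in Theta k m) \prod_(j < k) poisson_weight (x j * p j) (f j)) *
   (\sum_(g in Theta k n) \prod_(j < k) poisson_weight (x j * (1 - p j)) (g j)))%:E.
Proof.
apply: (@prob_weighted_sum_joint _ _ _ P k T U (fun j => poisson_weight (x j * p j))
  (fun j => poisson_weight (x j * (1 - p j)))) => //.
- move=> t u; apply: (mutually_independent_thinned (index_enum_uniq _)) => j _.
  by exists [set t j], [set u j].
- by move=> j t u; exact: prob_thinned_joint.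
Qed.

Lemma prob_weighted_failures n :
  P (weighted_sum U @^-1` [set n]) = (\sum_(f in Theta k n)
    \prod_(j < k) poisson_weight (x j * (1 - p j)) (f j))%:E.
Proof.
apply: (@prob_weighted_sum _ _ _ P k U (fun j => poisson_weight (x j * (1 - p j)))) => //.
- move=> u; apply: (mutually_independent_thinned (index_enum_uniq _)) => j _.
  by exists setT, [set u j]; rewrite preimage_setT setTI.
- by move=> j u; exact: prob_thinned_failures.
Qed.

End thinned_families.

(** * Rectangles and their Lebesgue measure *)

Section rectangle_facts.
Variable R : realType.

Lemma lebesgue_tuple_set0 n : lebesgue_tuple (set0 : set (n.-tuple R)) = 0%E.
Proof.
by elim: n => [|n IH] /=; [rewrite diracE in_set0|rewrite integral0_eq].
Qed.

(** The section at [y] is the rectangle of the remaining sides if [y] lies in [[0, x1]] and is empty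
    otherwise, so the integrand is a constant on an interval. *)
Lemma lebesgue_tuple_rectangle n (x : n.-tuple R) :
  (forall i, 0 <= tnth x i) ->
  lebesgue_tuple [set y | forall i, 0 <= tnth y i <= tnth x i] =
    (\prod_(i < n) tnth x i)%:E.
Proof.
elim: n x => [|n IH] x x0 /=.
  by rewrite big_ord0 diracE mem_set// => -[].
case/tupleP: x x0 => x1 x x0.
have x10 : 0 <= x1 by have := x0 ord0; rewrite tnth0.
have x'0 i : 0 <= tnth x i by have := x0 (lift ord0 i); rewrite tnthS.
pose c : \bar R := (\prod_(i < n) tnth x i)%:E.
rewrite (_ : (fun y => _) = (cst c \_ `[0, x1])); last first.
  apply/funext => y; rewrite patchE; case: ifPn => [|/negP] y01.
    rewrite -/c /c -(IH _ x'0); congr lebesgue_tuple.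
    move: y01; rewrite inE/= in_itv/= => y01.
    apply/seteqP; split => t /= tx i; first by have := tx (lift ord0 i); rewrite !tnthS.
    by case: (unliftP ord0 i) => [j|] ->; rewrite ?tnthS ?tnth0.
  rewrite -[RHS](lebesgue_tuple_set0 n); congr lebesgue_tuple.
  apply/seteqP; split => // t /= /(_ ord0); rewrite !tnth0 => y0.
  by apply: y01; rewrite inE/= in_itv.
rewrite -integral_mkcond.
pose D : set R := `[0, x1]%classic.
transitivity (c * lebesgue_measure D)%E.
  by apply: integral_cst; exact: measurable_itv.
rewrite /D lebesgue_measure_itv/= big_ord_recl tnth0.
rewrite lte_fin; under eq_bigr do rewrite tnthS.
(* The remaining case is the degenerate side [x1 = 0], where both members vanish. *)
rewrite -/c; case: ifPn => [_|]; first by rewrite -EFinB subr0 muleC EFinM.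
by rewrite -leNgt mule0 => x1le; rewrite (le_anti (introT andP (conj x1le x10))) mul0r.
Qed.

Lemma lebesgue_tuple_rectangle_lty d (A : set (d.-tuple R)) :
  rectangles A -> (lebesgue_tuple A < +oo)%E.
Proof. by move=> [x [x0 ->]]; rewrite lebesgue_tuple_rectangle// ltry. Qed.

Lemma rectangle_origin d (A : set (d.-tuple R)) :
  rectangles A -> A [tuple of nseq d 0].
Proof.
move=> [x [x0 ->]] i; rewrite (_ : tnth _ i = 0) ?lexx ?x0//.
by rewrite (tnth_nth 0) nth_nseq ltn_ord.
Qed.

(* Rectangles share the origin, so a disjoint family whose union is a
   rectangle has exactly one member. *)
Lemma integer_measure_on_rectangles d (mu : set (d.-tuple R) -> R) :
  (forall A, rectangles A -> exists n : nat, mu A = n%:R) ->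
  integer_measure_on (@rectangles R d) mu.
Proof.
move=> mu_nat; split => // D F rF tF /[dup] rU /rectangle_origin[i Di _].
have Di1 : D = [set i].
  apply/seteqP; split => [j Dj|j ->//]; apply: tF => //.
  by exists [tuple of nseq d 0]; split; apply: rectangle_origin; exact: rF.
rewrite Di1 bigcup_set1 esum_set1//.
by have [n ->] := mu_nat _ (rF _ Di); rewrite lee_fin ler0n.
Qed.

End rectangle_facts.

(** * Transfer along an almost sure identity *)

Section criteria.
Context (dO : measure_display) (Omega : measurableType dO) (R : realType).
Variable P : probability Omega R.
Variable O : set Omega.
Hypothesis mO : measurable O.
Hypothesis O0 : P (~` O) = 0%E.

(** [X] is known to agree with the natural-valued [Y] only on [O]. There its paths are integer
    measures, and the law of [Y] passes to [X]. *)
Lemma GPRF_ae_weighted_sum (d k : nat) (nu : 'I_k -> R)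
    (X : set (d.-tuple R) -> Omega -> R) (Y : set (d.-tuple R) -> Omega -> nat) :
  (forall A, rectangles A -> measurable_fun setT (X A)) ->
  (forall A, rectangles A -> forall n, measurable (Y A @^-1` [set n])) ->
  (forall A w, rectangles A -> O w -> X A w = (Y A w)%:R) ->
  (forall A, rectangles A -> forall n, P (Y A @^-1` [set n]) =
    (\sum_(f in Theta k n) \prod_(j < k)
       poisson_weight (nu j * fine (lebesgue_tuple A)) (f j))%:E) ->
  GPRF P nu X.
Proof.
move=> mX mY XY PY; split.
- split=> //; exists (~` O); split => //; first exact: measurableC.
  apply: subsetC => w Ow; apply: integer_measure_on_rectangles => A rA.
  by exists (Y A w); exact: XY.
- move=> A rA _ n /=; rewrite -PY//; apply: (prob_eq_ae mO O0).
  + rewrite -[X in measurable X]setTI; apply: (mX _ rA measurableT [set n%:R]).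
    exact: measurable_set1.
  + exact: mY.
  + apply/seteqP; split => w /= [Xn Ow]; split => //; last by rewrite XY// Xn.
    by apply/eqP; rewrite -(eqr_nat R) -XY// Xn.
(* The rectangles of index [ord0] and [ord_max] share the origin, so disjointness would identify two
   distinct indices. *)
- move=> [|[|m]] // A _ rA /(_ ord0 ord_max I I) tA; suff /tA : A ord0 `&` A ord_max !=set0 by [].
  by exists [tuple of nseq d 0]; split; exact: rectangle_origin.
Qed.

(** On [O], the event that [X] lies in [B] is the event that [X'] lies in the set of naturals whose
    image is in [B]; independence is then a matter of single values. *)
Lemma independent_ae_nat_valued (X Y : Omega -> R) (X' Y' : Omega -> nat) :
  measurable_fun setT X -> measurable_fun setT Y ->
  (forall n, measurable (X' @^-1` [set n])) ->
  (forall n, measurable (Y' @^-1` [set n])) ->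
  (forall w, O w -> X w = (X' w)%:R) -> (forall w, O w -> Y w = (Y' w)%:R) ->
  (forall m n, P (X' @^-1` [set m] `&` Y' @^-1` [set n]) =
               P (X' @^-1` [set m]) * P (Y' @^-1` [set n]))%E ->
  independent P (g_sigma_algebra_preimage X) (g_sigma_algebra_preimage Y).
Proof.
move=> mX mY mX' mY' XX' YY' iXY _ _ [B mB <-] [C mC <-].
pose nat_part (D : set R) : set nat := [set n | D n%:R].
have mXB := mX measurableT _ mB; have mYC := mY measurableT _ mC.
have mX'B : measurable (X' @^-1` nat_part B) by exact: measurable_preimage_nat.
have mY'C : measurable (Y' @^-1` nat_part C) by exact: measurable_preimage_nat.
have XB : (setT `&` X @^-1` B) `&` O = X' @^-1` nat_part B `&` O.
  by rewrite setTI; apply/seteqP; split => w /= [+ Ow]; rewrite /nat_part/= XX'.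
have YC : (setT `&` Y @^-1` C) `&` O = Y' @^-1` nat_part C `&` O.
  by rewrite setTI; apply/seteqP; split => w /= [+ Ow]; rewrite /nat_part/= YY'.
rewrite (prob_eq_ae mO O0 mXB mX'B XB) (prob_eq_ae mO O0 mYC mY'C YC).
rewrite -independent_nat_valued//; apply: (prob_eq_ae mO O0).
- exact: measurableI.
- exact: measurableI.
- by rewrite -(setIid O) setIACA XB YC setIACA.
Qed.

End criteria.

(** * Measurability of random sums and counts, then the thinned fields *)

Lemma measurable_random_sum (d : measure_display) (T : measurableType d)
    (R : realType) (N : T -> nat) (Z : nat -> T -> R) :
  (forall n, measurable (N @^-1` [set n])) ->
  (forall r, measurable_fun setT (Z r)) ->
  measurable_fun setT (fun w => \sum_(r < N w) Z r w).
Proof.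
move=> mN mZ _ B mB; rewrite setTI.
have -> : (fun w => \sum_(r < N w) Z r w) @^-1` B =
    \bigcup_n (N @^-1` [set n] `&` (fun w => \sum_(r < n) Z r w) @^-1` B).
  by apply/seteqP; split => [w Bw|w [n _ [/= <-]]//]; exists (N w).
apply: bigcup_measurable => n _; apply: measurableI => //.
have := measurable_sum (index_enum 'I_n) (fun r : 'I_n => mZ r).
by move=> /(_ measurableT B mB); rewrite setTI.
Qed.

Lemma measurable_nat_preimage (d : measure_display) (T : measurableType d)
    (R : realType) (X : T -> nat) n :
  measurable_fun setT (fun w => (X w)%:R : R) -> measurable (X @^-1` [set n]).
Proof.
move=> mX; have -> : X @^-1` [set n] = setT `&` (fun w => (X w)%:R) @^-1` [set n%:R : R].
  rewrite setTI; apply/seteqP; split => w /=; first by move=> ->.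
  by move/eqP; rewrite eqr_nat => /eqP.
by apply: mX => //; exact: measurable_set1.
Qed.

Theorem proposition2p3 (dO : measure_display) (Omega : measurableType dO)
    (R : realType) (P : probability Omega R) (d k : nat)
    (lambda p : 'I_k -> R)
    (N : 'I_k -> set (d.-tuple R) -> Omega -> nat)
    (M S : set (d.-tuple R) -> Omega -> R)
    (Z : 'I_k -> nat -> {RV P >-> R}) :
  (1 <= d)%N -> (1 <= k)%N ->
  (forall j, 0 < lambda j) ->
  (forall j, 0 < p j < 1) ->
  (* N_1, ..., N_k are independent Poisson random fields *)
  (forall j, PRF P (lambda j) (N j)) ->
  mutually_independent P (fun j => sigma_family (@rectangles R d) (N j)) ->
  (* M = \sum_j j N_j *)
  (forall A, rectangles A -> forall w,
     M A w = \sum_(j < k) (j.+1 * N j A w)%:R) ->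
  GPRF P lambda M ->
  (* the independent iid sequences; Z j r is the variable of rank r.+1 *)
  (forall j, iid (Z j)) ->
  (forall j : 'I_k, P [set w | Z j 0%N w = j.+1%:R] = (p j)%:E) ->
  (forall j : 'I_k, P [set w | Z j 0%N w = 0] = (1 - p j)%:E) ->
  mutually_independent P (fun j => sigma_family setT (Z j : nat -> Omega -> R)) ->
  (* they are independent of the fields N_1, ..., N_k from which M is built *)
  independent P
    (sigma_family setT (fun jr : 'I_k * nat => Z jr.1 jr.2 : Omega -> R))
    (sigma_family [set jA : 'I_k * set (d.-tuple R) | rectangles jA.2]
       (fun jA => N jA.1 jA.2)) ->
  (* S_M *)
  (forall A, rectangles A -> forall w,
     S A w = \sum_(j < k) \sum_(r < N j A w) Z j r w) ->
  [/\ GPRF P (fun j => lambda j * p j) S,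
      GPRF P (fun j => lambda j * (1 - p j)) (fun A w => M A w - S A w)
    & forall A, rectangles A ->
        independent P (g_sigma_algebra_preimage (S A))
          (g_sigma_algebra_preimage (fun w => M A w - S A w))].
Proof.
move=> _ _ _ _ PRFN iN MN _ iidZ PZ1 PZ0 iZ indZN SE.
(* Success is a nonzero value; off a null event this is the value [j.+1]. *)
pose B j r : set Omega := Z j r @^-1` [set~ 0].
have mZ j r : measurable_fun setT (Z j r) by exact: measurable_funPT.
have mZpre j r (D : set R) : measurable D -> measurable (Z j r @^-1` D).
  by move=> mD; rewrite -[X in measurable X]setTI; exact: mZ.
have distZ j r (D : set R) : measurable D -> P (Z j r @^-1` D) = P (Z j 0%N @^-1` D).
  by move=> mD; exact: (iidZ j).2.
have mB j r : measurable (B j r).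
  by apply: mZpre; apply: measurableC; exact: measurable_set1.
have PB j r : P (B j r) = (p j)%:E.
  rewrite distZ; last by apply: measurableC; exact: measurable_set1.
  rewrite -preimage_setC probability_setC; last by apply: mZpre; exact: measurable_set1.
  by rewrite PZ0 -EFinB opprB addrCA subrr addr0.
have sigmaB j r : g_sigma_algebra_preimage (Z j r) (B j r).
  by exists [set~ 0]; [apply: measurableC; exact: measurable_set1|rewrite setTI].
have iB j : mutually_independent P (fun r => [set B j r; ~` B j r]).
  apply: mutually_independent_sub (iidZ j).1 => r _ [->|->]; first exact: sigmaB.
  by exists [set 0]; [exact: measurable_set1|rewrite setTI /B preimage_setC setCK].
have iBs : mutually_independent P (fun j => <<s range (B j)>>).
  apply: mutually_independent_sub iZ => j; apply: sub_sigma_algebra2 => _ [r _ <-].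
  by exists r.
(* One almost sure event serves all [j] and [r]: there are finitely many [j] and countably many [r],
   and each exceptional event has probability [1 - ((1 - p j) + p j) = 0]. *)
have [G [mG G0 GZ]] : exists G : set Omega, [/\ measurable G, P (~` G) = 0%E &
    forall w, G w -> forall j r, Z j r w = (j.+1 * (w \in B j r))%:R].
  have aeZ : \forall w \ae P, forall (j : 'I_k) (r : nat),
      Z j r w = (j.+1 * (w \in B j r))%:R.
    apply: filter_forall => j; apply: ae_foralln => r.
    pose D : set R := [set 0; j.+1%:R].
    exists (~` (Z j r @^-1` D)).
    have mD : measurable D.
      by apply: measurableU; exact: measurable_set1.
    split.
    - by apply: measurableC; exact: mZpre.
    - transitivity (1 - P (Z j r @^-1` D))%E.
        by apply: probability_setC; exact: mZpre.
      rewrite distZ// preimage_setU.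
      have -> : P (Z j 0%N @^-1` [set 0] `|` Z j 0%N @^-1` [set j.+1%:R]) =
          (P [set w | Z j 0%N w = 0%R] + P [set w | Z j 0%N w = j.+1%:R])%E.
        apply: measureU; try by apply: mZpre; exact: measurable_set1.
        by apply/seteqP; split => // w /= [->] /eqP; rewrite eq_sym pnatr_eq0.
      by rewrite PZ0 PZ1 -EFinD addrNK subrr.
    - apply: subsetC => w /= [Z0|Zj].
        by rewrite memNset ?muln0//= /B/= => /(_ Z0).
      by rewrite mem_set ?muln1// /B/= Zj => /eqP; rewrite pnatr_eq0.
  have [C [mC C0 CZ]] := aeZ; exists (~` C); split; first exact: measurableC.
    by rewrite setCK.
  by move=> w /(subsetC CZ); rewrite setCK.
have mNR j A : rectangles A -> measurable_fun setT (fun w => (N j A w)%:R : R).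
  by move=> rA; have [[+ _] _ _] := PRFN j; exact.
have mN A : rectangles A -> forall j n, measurable (N j A @^-1` [set n]).
  by move=> rA j n; exact: measurable_nat_preimage (mNR j A rA).
pose x (A : set (d.-tuple R)) j := lambda j * fine (lebesgue_tuple A).
have PN A : rectangles A -> forall j n,
    P (N j A @^-1` [set n]) = (poisson_weight (x A j) n)%:E.
  move=> rA j n; have [_ + _] := PRFN j.
  by move=> /(_ A rA (lebesgue_tuple_rectangle_lty rA) n).
(* With [A] fixed, the events of [N j A] lie in the sigma-algebra of the whole field [N j], so
   independence of the fields restricts to them. *)
have iNA A : rectangles A ->
    mutually_independent P (fun j => range (fun n => N j A @^-1` [set n])).
  move=> rA; apply: mutually_independent_sub iN => j _ [n _ <-].
  by apply: sub_sigma_algebra; exists A => //; exists [set n]; rewrite ?setTI.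
have iBN A : rectangles A -> independent P
    <<s range (fun jr : 'I_k * nat => B jr.1 jr.2)>>
    <<s range (fun jn : 'I_k * nat => N jn.1 A @^-1` [set jn.2])>>.
  move=> rA E F BE NF; apply: indZN.
    by apply: sub_sigma_algebra2 BE => _ [[j r] _ <-]; exists (j, r).
  apply: sub_sigma_algebra2 NF => _ [[j n] _ <-]; exists (j, A) => //.
  by exists [set n]; rewrite ?setTI.
pose T A j := thinned (N j A) (B j).
pose U A j := thinned (N j A) (fun r => ~` B j r).
have mT A : rectangles A -> forall j t, measurable (T A j @^-1` [set t]).
  by move=> rA j t; apply: measurable_thinned => // n; exact: mN.
have mU A : rectangles A -> forall j t, measurable (U A j @^-1` [set t]).
  move=> rA j t; apply: measurable_thinned => [n|r]; first exact: mN.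
  exact: measurableC.
have ST A w : rectangles A -> G w -> S A w = (weighted_sum (T A) w)%:R.
  move=> rA Gw; rewrite SE// /weighted_sum natr_sum; apply: eq_bigr => j _.
  rewrite /T /thinned /success_count big_distrr natr_sum.
  by apply: eq_bigr => r _; rewrite GZ.
(* Each of the [N j A w] trials succeeds or fails, so removing the successes leaves the failures
   with the same weight [j.+1]. *)
have MSU A w : rectangles A -> G w -> M A w - S A w = (weighted_sum (U A) w)%:R.
  move=> rA Gw; rewrite ST// MN// /weighted_sum !natr_sum -sumrB.
  apply: eq_bigr => j _; rewrite -(thinnedC (N j A) (B j)) mulnDr natrD.
  by rewrite addrAC subrr add0r.
have mS A : rectangles A -> measurable_fun setT (S A).
  move=> rA; rewrite (_ : S A = fun w => \sum_(j < k) \sum_(r < N j A w) Z j r w).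
    by apply: measurable_sum => j; exact: (measurable_random_sum (mN _ rA j) (mZ j)).
  by apply/funext => w; exact: SE.
have mM A : rectangles A -> measurable_fun setT (M A).
  move=> rA; rewrite (_ : M A = fun w => \sum_(j < k) j.+1%:R * (N j A w)%:R).
    apply: measurable_sum => j; apply: measurable_realfun.measurable_funM; last exact: mNR.
    exact: measurable_cst.
  by apply/funext => w; rewrite MN//; apply: eq_bigr => j _; rewrite natrM.
have mMS A : rectangles A -> measurable_fun setT (fun w => M A w - S A w).
  by move=> rA; apply: measurable_realfun.measurable_funB; [exact: mM|exact: mS].
have PT A : rectangles A -> forall n, P (weighted_sum (T A) @^-1` [set n]) =
    (\sum_(f in Theta k n) \prod_(j < k)
       poisson_weight (x A j * p j) (f j))%:E.
  move=> rA n; apply: prob_weighted_successes => //; [exact: mN|exact: PN|exact: iNA|exact: iBN].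
have PU A : rectangles A -> forall n, P (weighted_sum (U A) @^-1` [set n]) =
    (\sum_(f in Theta k n) \prod_(j < k)
       poisson_weight (x A j * (1 - p j)) (f j))%:E.
  move=> rA n; apply: prob_weighted_failures => //; [exact: mN|exact: PN|exact: iNA|exact: iBN].
split.
- apply: (GPRF_ae_weighted_sum mG G0 (Y := fun A => weighted_sum (T A))) => //.
  + by move=> A rA n; apply: measurable_weighted_sum; exact: mT.
  + move=> A rA n; rewrite PT//; congr EFin; apply: eq_bigr => f _.
    by apply: eq_bigr => j _; rewrite /x mulrAC.
- apply: (GPRF_ae_weighted_sum mG G0 (Y := fun A => weighted_sum (U A))) => //.
  + by move=> A rA n; apply: measurable_weighted_sum; exact: mU.
  + move=> A rA n; rewrite PU//; congr EFin; apply: eq_bigr => f _.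
    by apply: eq_bigr => j _; rewrite /x mulrAC.
- move=> A rA; apply: (independent_ae_nat_valued mG G0
    (X' := weighted_sum (T A)) (Y' := weighted_sum (U A))).
  + exact: mS.
  + exact: mMS.
  + by move=> n; apply: measurable_weighted_sum; exact: mT.
  + by move=> n; apply: measurable_weighted_sum; exact: mU.
  + by move=> w Gw; rewrite ST.
  + by move=> w Gw; rewrite MSU.
  (* The joint law is the product of the two laws [PT] and [PU]. *)
  + move=> m n; rewrite PT// PU// -EFinM.
    by apply: prob_weighted_joint => //; [exact: mN|exact: PN|exact: iNA|exact: iBN].
Qed.
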